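(* Let $\theta$ be a primitive aperiodic length-$\ell$ substitution on a finite alphabet $\mathcal A$, in simplified form, and let $\mathcal M_\theta$ be the semigroup automaton associated to $\theta$, with initial state $\mathrm{id}$ and transition function $\delta$. Let $\boldsymbol{u}=(u_n)_{n\in\mathbb Z}$ be a fixed point of $\theta$, generated (in reverse reading) by $(\mathcal M_\theta,\{\omega_l,\omega_r\})$. If the substitution shift $(X_\theta,\sigma)$ is Toeplitz, then $$\mathrm{Per}(\boldsymbol{u})=\{n\in\mathbb Z:\ \delta(\mathrm{id},(n)_\ell)=\pi_{u_n}\},$$ where $(n)_\ell$ is the canonical base-$\ell$ expansion of $n$. Hence the reduced graph of $\theta$ is a description of the set of semicocycle discontinuities of $\boldsymbol{u}$.
   Context: **Substitutions.** A length-$\ell$ substitution is a map $\theta:\mathcal A\to\mathcal A^\ell$, written $\theta(a)=\theta_0(a)\cdots\theta_{\ell-1}(a)$ with column maps $\theta_i:\mathcal A\to\mathcal A$. It extends by concatenation to words and to $\mathcal A^{\mathbb Z}$, with $\theta(\boldsymbol{x})_{k\ell+r}=\theta_r(x_k)$ for $k\in\mathbb Z$, $0\le r\le\ell-1$. A fixed point is a $\boldsymbol{u}$ with $\theta(\boldsymbol{u})=\boldsymbol{u}$; a $\theta$-periodic point satisfies $\theta^k(\boldsymbol{u})=\boldsymbol{u}$ for some $k\ge1$. $\theta$ is primitive if there is $n\ge1$ such that for all $a,b\in\mathcal A$ the letter $a$ occurs in $\theta^n(b)$. It is aperiodic if its $\theta$-periodic points are not shift-periodic. It is in simplified form if $\theta_0\circ\theta_0=\theta_0$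 and $\theta_{\ell-1}\circ\theta_{\ell-1}=\theta_{\ell-1}$. **Shifts.** $\mathcal A^{\mathbb Z}$ carries the product topology and $\sigma$ is the left shift. For $\theta$ primitive, $X_\theta\subset\mathcal A^{\mathbb Z}$ is the shift orbit closure of any two-sided $\theta$-periodic point. For a sequence $(\ell_n)_{n\ge1}$ of natural numbers, the odometer $(\mathbb Z_{(\ell_n)},+1)$ is the group $\varprojlim\mathbb Z/(\ell_1\cdots\ell_n)\mathbb Z$ with translation by $1$; $\mathbb Z_\ell$ denotes the case $\ell_n=\ell$ for all $n$ (the $\ell$-adic integers). A Toeplitz shift is a shift $(X,\sigma)$, $X\subset\mathcal A^{\mathbb Z}$, which is a somewhere one-to-one extension of an odometer, i.e. there is a factor map from $(X,\sigma)$ onto an odometer having at least one singleton fibre. **Canonical base-$\ell$ expansions.** For $n\in\mathbb N$, $(n)_\ell=n_{j-1}\cdots n_0$ where $n=\sum_{i=0}^{j-1}n_i\ell^i$, $n_i\in\{0,\dots,\ell-1\}$ and $n_{j-1}\ne0$; also $(0)_\ell=0$. For a negative integer $-n$, where $(n)_\ell$ has length $j$, let $w\in\{0,\dots,\ell-1\}^j$ be the word of length $j$ such that adding $(n)_\ell$ and $w$ with carry gives $1$ followed by $j$ zeros; then $(-n)_\ell=\cdots(\ell-1)(\ell-1)w$. Since the transition function accepts only finite words, the finite word $(\ell-1)w$ is fed in to the automaton in place of this infinite expansion. **Semigroup automaton.** $\mathcal S_\theta:=\langle\mathrm{id},\theta_i:0\le i\le\ell-1\rangle$ is the semigroup generated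 under composition in $\mathcal A^{\mathcal A}$ by the identity map and the column maps. $\mathcal M_\theta$ has state set $\mathcal S_\theta$, input alphabet $\{0,\dots,\ell-1\}$, initial state $\mathrm{id}$, and transition function $\delta(s,i)=s\circ\theta_i$. In reverse reading, $\delta(s,n_k\cdots n_1n_0)$ is obtained by feeding in first $n_0$, then $n_1$, and so on up to $n_k$; thus $\delta(\mathrm{id},n_k\cdots n_0)=\theta_{n_0}\circ\cdots\circ\theta_{n_k}$. The output maps are $\omega_r(s)=s(u_0)$ and $\omega_l(s)=s(u_{-1})$; with these, $\boldsymbol{u}$ is generated by $u_n=\omega_r(\delta(\mathrm{id},(n)_\ell))$ for $n\ge0$ and $u_n=\omega_l(\delta(\mathrm{id},(n)_\ell))$ for $n<0$. **Reduced graph.** $\pi_a\in\mathcal A^{\mathcal A}$ is the constant map $x\mapsto a$. A state $s\in\mathcal S_\theta$ is a $1$-vertex if the map $s:\mathcal A\to\mathcal A$ has image of cardinality $1$. When $\theta$ has a coincidence (for a primitive aperiodic length-$\ell$ substitution this is equivalent to $(X_\theta,\sigma)$ being a Toeplitz shift, and then some composition of column maps of $\theta$ is constant), the reduced graph of $\theta$ is obtained from $\mathcal M_\theta$ by removing all $1$-vertices and all edges leading to them. **Periodic part.** For $\boldsymbol{x}\in\mathcal A^{\mathbb Z}$, $k\in\mathbb N$, $a\in\mathcal A$, define recursively $$\mathrm{Per}_k(\boldsymbol{x},a)=\{n\in\mathbb Z:\ x_{n'}=a\text{ for all }n'\equiv n\bmod k,\text{ and }n\notin\mathrm{Per}_j(\boldsymbol{x},b)\text{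 for any }b\in\mathcal A\text{ and any proper divisor }j\text{ of }k\},$$ $\mathrm{Per}_k(\boldsymbol{x})=\bigcup_{a\in\mathcal A}\mathrm{Per}_k(\boldsymbol{x},a)$ and $\mathrm{Per}(\boldsymbol{x})=\bigcup_k\mathrm{Per}_k(\boldsymbol{x})$. **Semicocycle.** The semicocycle defined by $\boldsymbol{u}$ is the map $n\in\mathbb Z\mapsto u_n\in\mathcal A$, where $\mathcal A$ is discrete and $\mathbb Z$ carries the topology inherited from $\mathbb Z_\ell$ (two integers are close if and only if their base-$\ell$ expansions agree on a large block of least significant digits).
   Formalization: For n ≥ 0 the equality feeds the word 0(n)_ℓ instead of (n)_ℓ (the literal equality fails; only its inclusion into Per(u) is kept), and ''Toeplitz'' means a somewhere one-to-one extension of the ℓ-adic odometer, since the claim fails for other odometers (height > 1). *)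

(* Defs.v *)
From HB Require Import structures.
From mathcomp Require Import all_boot all_order all_algebra.
From mathcomp Require Import all_classical all_reals all_analysis.

Set Implicit Arguments.
Unset Strict Implicit.
Unset Printing Implicit Defensive.

Import GRing.Theory.
Local Open Scope classical_set_scope.

(* The full shift: product topology over the discrete finite alphabet. *)
Notation biseq A := {ptws int -> discrete_topology A}.

Section Substitution.
Variables (A : finType) (l : nat).
Implicit Types (theta : A -> l.-tuple A) (x : int -> A).

(* Column maps theta_i.  Only indices i < l are meaningful; using nat indices
   (with the identity as junk value) keeps base-l digits plain numbers. *)
Definition column theta (i : nat) : {ffun A -> A} :=
  [ffun a => nth a (theta a) i].

Definition subst_word theta (w : seq A) : seq A :=
  flatten [seq tval (theta a) | a <- w].

Definition subst_biseq theta x : int -> A :=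
  fun n => column theta `|(n %% l)%Z|%N (x (n %/ l)%Z).

Definition fixed_point theta x : Prop := subst_biseq theta x = x.

Definition theta_periodic theta x : Prop :=
  exists2 k, (0 < k)%N & iter k (subst_biseq theta) x = x.

Definition shift_by (n : int) x : int -> A := fun m => x (m + n)%R.

Definition shift_periodic x : Prop :=
  exists2 p : nat, (0 < p)%N & shift_by p x = x.

Definition primitive theta : Prop :=
  exists2 n, (0 < n)%N &
    forall a b : A, a \in iter n (subst_word theta) [:: b].

Definition aperiodic theta : Prop :=
  forall x, theta_periodic theta x -> ~ shift_periodic x.

Definition simplified theta : Prop :=
  (forall a, column theta 0 (column theta 0 a) = column theta 0 a) /\
  (forall a, column theta l.-1 (column theta l.-1 a) = column theta l.-1 a).

Definition orbit_closure (x : biseq A) : set (biseq A) :=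
  closure [set (shift_by n x : biseq A) | n in [set: int]].

(* X_theta is the orbit closure of any theta-periodic point; for primitive
   theta it does not depend on that point, so it is given as a relation. *)
Definition is_substitution_shift theta (X : set (biseq A)) : Prop :=
  exists2 v : int -> A, theta_periodic theta v & X = orbit_closure v.

End Substitution.

Section Odometer.
Variable ls : nat -> nat.

Definition odometer_modulus (n : nat) : nat := (\prod_(i < n) ls i)%N.

(* The inverse limit of the Z/(ls 0 * ... * ls (n-1)), as compatible sequences
   of canonical residues.  The topology is the one induced from the product of
   discrete spaces {ptws nat -> nat}. *)
Definition odometer : set {ptws nat -> nat} :=
  [set z | forall n, (z n < odometer_modulus n)%N /\
                     (z n.+1 %% odometer_modulus n)%N = z n].

Definition odometer_succ (z : {ptws nat -> nat}) : {ptws nat -> nat} :=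
  fun n => ((z n).+1 %% odometer_modulus n)%N.

Definition odometer_of_int (m : int) : {ptws nat -> nat} :=
  fun n => `|(m %% odometer_modulus n)%Z|%N.

(* Toeplitz shift with a prescribed underlying odometer.  For a length-l
   substitution the odometer must be the l-adic one if being Toeplitz is to
   match having a coincidence: with height h > 1 the shift can be a somewhere
   one-to-one extension of Z_l * Z/h although no composition of column maps is
   constant. *)
Definition toeplitz_shift_over (A : finType) (X : set (biseq A)) : Prop :=
  exists pi : biseq A -> {ptws nat -> nat},
    [/\ {within X, continuous pi},
        pi @` X = odometer,
        forall x, X x -> pi (shift_by 1 x) = odometer_succ (pi x) &
        exists2 x, X x & forall y, X y -> pi y = pi x -> y = x].

End Odometer.

Definition ladic_seq (l : nat) : nat -> nat := fun=> l.

Definition ladic_integers (l : nat) : set {ptws nat -> nat} :=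
  odometer (ladic_seq l).

(* z n is the residue mod l^n, so digit k is read off from z k.+1. *)
Definition ladic_digit (l : nat) (z : nat -> nat) (k : nat) : nat :=
  (z k.+1 %/ l ^ k)%N.

Definition ladic_of_int (l : nat) : int -> {ptws nat -> nat} :=
  odometer_of_int (ladic_seq l).

Section Expansions.
Variable l : nat.

(* All words of digits are listed least significant digit first, so that
   reading them from left to right is reverse reading. *)
Definition digits (j n : nat) : seq nat :=
  mkseq (fun i => ((n %/ l ^ i) %% l)%N) j.

(* Length of (n)_l; trunc_log l 0 = 0, so (0)_l is the one-letter word 0. *)
Definition expansion_length (n : nat) : nat := (trunc_log l n).+1.

(* For a negative integer -m with (m)_l of length j, w is the word of j digits
   of l^j - m, and the finite word fed to the automaton is (l-1)w. *)
Definition canonical_word (n : int) : seq nat :=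
  match n with
  | Posz m => digits (expansion_length m) m
  | Negz m' =>
      let m := m'.+1 in
      let j := expansion_length m in
      rcons (digits j (l ^ j - m)%N) l.-1
  end.

(* As an l-adic integer, n is an infinite expansion with constant tail 0
   (n >= 0) or l-1 (n < 0); here one digit of the tail is kept in both cases.
   For n < 0 the canonical word (l-1)w already contains such a digit.  For
   n > 0 the digit 0 matters: with 0 -> 001, 1 -> 011 the letters u_(9m+1) are
   all 0, theta_1 o theta_0 is constant, but theta_1 is the identity. *)
Definition tail_word (n : int) : seq nat :=
  match n with
  | Posz _ => rcons (canonical_word n) 0%N
  | Negz _ => canonical_word n
  end.

End Expansions.

Section Automaton.
Variables (A : finType) (l : nat) (theta : A -> l.-tuple A).
Implicit Types s t : {ffun A -> A}.

Definition ffun_id : {ffun A -> A} := [ffun a => a].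

Definition ffun_comp s t : {ffun A -> A} := [ffun a => s (t a)].

Definition ffun_cst (a : A) : {ffun A -> A} := [ffun=> a].

Inductive column_semigroup : {ffun A -> A} -> Prop :=
| semigroup_id : column_semigroup ffun_id
| semigroup_column i of (i < l)%N : column_semigroup (column theta i)
| semigroup_comp s t of column_semigroup s & column_semigroup t :
    column_semigroup (ffun_comp s t).

Definition delta s (i : nat) : {ffun A -> A} := ffun_comp s (column theta i).

Definition delta_word s (w : seq nat) : {ffun A -> A} := foldl delta s w.

Lemma delta_semigroup s i :
  (i < l)%N -> column_semigroup s -> column_semigroup (delta s i).
Proof. by move=> il Ss; apply: semigroup_comp => //; apply: semigroup_column. Qed.

Definition omega_r (u : int -> A) s : A := s (u 0%R).

Definition omega_l (u : int -> A) s : A := s (u (-1)%R).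

Definition generated_by_automaton (u : int -> A) : Prop :=
  forall n : int,
    u n = (if (0 <= n)%R then omega_r u else omega_l u)
            (delta_word ffun_id (canonical_word l n)).

Definition one_vertex s : Prop := #|s @: [set: A]%SET| = 1%N.

Definition reduced_vertex s : Prop := column_semigroup s /\ ~ one_vertex s.

Definition reduced_edge s (i : nat) t : Prop :=
  [/\ reduced_vertex s, reduced_vertex t, (i < l)%N & t = delta s i].

Definition reduced_infinite_path (d : nat -> nat) : Prop :=
  exists v : nat -> {ffun A -> A},
    v 0%N = ffun_id /\ forall k, reduced_edge (v k) (d k) (v k.+1).

End Automaton.

Section PeriodicPart.
Variables (A : finType) (x : int -> A).

(* The recursion on proper divisors is run with fuel m; fuel m >= k suffices. *)
Fixpoint Per_fuel (m k : nat) (a : A) (n : int) : Prop :=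
  if m is m'.+1 then
    (forall n' : int, (n' = n %[mod k])%Z -> x n' = a) /\
    (forall j, (j %| k)%N -> (j < k)%N -> forall b, ~ Per_fuel m' j b n)
  else False.

Definition Per_letter (k : nat) (a : A) : set int := [set n | Per_fuel k k a n].

Lemma Per_fuelE m m' k a n : (0 < k)%N -> (k <= m)%N -> (k <= m')%N ->
  Per_fuel m k a n <-> Per_fuel m' k a n.
Proof.
elim: m m' k a n => [|m IH] [|m'] k a n k0 //=; try by case: k k0.
move=> km km'; split=> -[xa H]; split=> // j jk jltk b.
- have j0 : (0 < j)%N by rewrite (dvdn_gt0 k0 jk).
  rewrite -(IH m' j b n j0); first exact: H.
  + by rewrite -ltnS (leq_trans jltk).
  + by rewrite -ltnS (leq_trans jltk).
- have j0 : (0 < j)%N by rewrite (dvdn_gt0 k0 jk).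
  rewrite (IH m' j b n j0); first exact: H.
  + by rewrite -ltnS (leq_trans jltk).
  + by rewrite -ltnS (leq_trans jltk).
Qed.

Lemma Per_letterE k a n : (0 < k)%N ->
  Per_letter k a n <->
  (forall n' : int, (n' = n %[mod k])%Z -> x n' = a) /\
  (forall j, (j %| k)%N -> (j < k)%N -> forall b, ~ Per_letter j b n).
Proof.
case: k => // k _; rewrite /Per_letter /=.
split=> -[xa H]; split=> // j jk jltk b.
- rewrite (@Per_fuelE j k) //; first exact: H.
  by rewrite (dvdn_gt0 _ jk).
- rewrite (@Per_fuelE k j) //; first exact: H.
  by rewrite (dvdn_gt0 _ jk).
Qed.

Definition Per_period (k : nat) : set int :=
  \bigcup_(a in [set: A]) Per_letter k a.

Definition Per : set int := \bigcup_(k in [set k | (0 < k)%N]) Per_period k.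

End PeriodicPart.

Section Semicocycle.
Variables (A : finType) (l : nat) (u : int -> A).

(* Z with the topology inherited from the l-adic integers. *)
Definition semicocycle :
  initial_topology (ladic_of_int l) -> discrete_topology A := u.

Definition integer_discontinuities : set int :=
  [set n : int | ~ {for (n : initial_topology (ladic_of_int l)),
                     continuous semicocycle}].

(* The l-adic integers z at which the semicocycle has no continuous extension,
   i.e. at which u n has no limit (in the discrete space A) as n tends to z. *)
Definition ladic_discontinuities : set {ptws nat -> nat} :=
  [set z | ladic_integers l z /\
     ~ exists a : A, exists2 U, nbhs z U &
         forall n : int, U (ladic_of_int l n) -> u n = a].

End Semicocycle.

(* Main.v *)
Require Import Defs.
From HB Require Import structures.
From mathcomp Require Import all_boot all_order all_algebra.
From mathcomp Require Import all_classical all_reals all_analysis.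
From mathcomp Require Import zify.

(** A word w of base-l digits, least significant first, has a value V < l^|w|
    and labels a path from id in the automaton, ending in a composition s_w of
    column maps.  Everything rests on one identity for a fixed point u,
      u (q * l^|w| + V) = s_w (u q)        (fixed_point_delta_word),
    which says that s_w transports u to the arithmetic progression V + l^|w| Z.
    By primitivity every letter is some u q, so u is constant on that
    progression exactly when s_w is a constant map.

    The discontinuities follow at once: the progressions z_j + l^j Z are the
    traces on the integers of a neighbourhood basis of an l-adic integer z, so
    u has a limit at z iff one of the states on the path labelled by the digits
    of z is constant, i.e. iff this path leaves the reduced graph
    (ladic_limitP, reduced_infinite_pathP).

    The identity also gives a period l^|w| of u at n as soon as the word of n
    leads to a constant map (Per_word).  For the converse suppose that u has
    the period k at n, and write k | q * l^j with q coprime to l.  Padding the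
    word of n by j digits of its tail (0 or l-1) does not change the map
    s_w, because theta_0 and theta_(l-1) are idempotent; and for the padded
    word w the period gives u = u_n at all n + m q l^|w|, that is, s_w sends
    all letters u (e + m q) to u_n, where e is 0 or -1.  It remains that every
    letter occurs in u in each residue class modulo q.  This holds when some
    composition of column maps is constant (occurs_in_residue_class).

    That such a coincidence exists is where the Toeplitz hypothesis enters
    (toeplitz_coincidence).  Let x be the only point in its fibre over the
    l-adic integers.  By compactness, points of X whose image is close to that
    of x agree with x at 0; hence x has a period l^N at 0.  On a long window x
    is a shift of a theta-periodic point v, and the positions 0, l^N, 2 l^N, ...
    of the window carry the images, under one and the same composition of
    column maps, of consecutive letters of v.  These are all the letters, and
    their images are all equal to x_0. *)

Set Implicit Arguments.
Unset Strict Implicit.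
Unset Printing Implicit Defensive.

Import GRing.Theory.
Local Open Scope classical_set_scope.

Local Notation word_map theta := (delta_word theta (ffun_id _)).

(** * Digit words and compositions of column maps *)

Definition word_value (l : nat) (w : seq nat) : nat :=
  foldr (fun d v => (d + l * v)%N) 0%N w.

Lemma word_value_cat l w w' :
  word_value l (w ++ w') = (word_value l w + l ^ size w * word_value l w')%N.
Proof.
elim: w => [|d w IH] /=; first by rewrite expn0 mul1n.
by rewrite IH expnS mulnDr addnA mulnA.
Qed.

Lemma word_value_lt l w : (0 < l)%N -> all (gtn l) w ->
  (word_value l w < l ^ size w)%N.
Proof.
move=> l0; elim: w => [|d w IH] //= /andP[dl /IH {}IH].
by rewrite expnS; nia.
Qed.

Lemma word_value_digits l j n : (0 < l)%N ->
  word_value l (digits l j n) = (n %% l ^ j)%N.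
Proof.
move=> l0; elim: j => [|j IH]; first by rewrite modn1.
rewrite /digits mkseqS -cats1 word_value_cat IH size_mkseq /= muln0 addn0.
have rlt : (n %% l ^ j < l ^ j)%N by rewrite ltn_mod expn_gt0 l0.
have dlt : ((n %/ l ^ j) %% l < l)%N by rewrite ltn_mod.
rewrite [in RHS](divn_eq n (l ^ j)) [in RHS](divn_eq (n %/ l ^ j) l) mulnDl.
rewrite -mulnA -expnS -addnA modnMDl.
move: rlt dlt; set r := (n %% _)%N; set d := (_ %% l)%N => rlt dlt.
by rewrite modn_small ?expnS; nia.
Qed.

Lemma delta_word_cons (A : finType) l (theta : A -> l.-tuple A) d w a :
  word_map theta (d :: w) a
    = column theta d (word_map theta w a).
Proof.
rewrite /delta_word /=.
have E s : foldl (delta theta) s w a = s (foldl (delta theta) (ffun_id A) w a).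
  elim: w s a => [|e w IH] s a /=; first by rewrite ffunE.
  by rewrite IH (IH (delta _ _ e)) !ffunE.
by rewrite E [in RHS]E !ffunE.
Qed.

Lemma delta_word_cat (A : finType) l (theta : A -> l.-tuple A) w w' a :
  word_map theta (w ++ w') a
    = word_map theta w (word_map theta w' a).
Proof.
elim: w => [|d w IH] /=; first by rewrite [in RHS]ffunE.
by rewrite !delta_word_cons IH.
Qed.

(** Each application of theta multiplies positions by l and applies the column
    map of the new least significant digit, hence digits read from the least
    significant one compose column maps from the outside in.  The iterate is
    kept on the left so that the identity also serves theta-periodic points. *)
Lemma iter_subst_biseq (A : finType) l (theta : A -> l.-tuple A) x w (q : int) :
  all (gtn l) w ->
  iter (size w) (subst_biseq theta) x (q * (l ^ size w)%N + word_value l w)%R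
    = word_map theta w (x q).
Proof.
elim: w => [|d w IH] /=.
  by move=> _; rewrite expn0 ffunE; congr x; lia.
case/andP=> dl wl; rewrite delta_word_cons -IH // {1}/subst_biseq.
have -> : (q * (l ^ (size w).+1)%N + (d + l * word_value l w)%N
  = (q * (l ^ size w)%N + word_value l w) * l + d :> int)%R.
  by rewrite expnS; lia.
have l0 : (l%:Z != 0)%R by lia.
rewrite divzMDl // modzMDl divz_small ?modz_small; try by lia.
by rewrite addr0.
Qed.

Lemma fixed_point_delta_word (A : finType) l (theta : A -> l.-tuple A) u w
    (q : int) :
  fixed_point theta u -> all (gtn l) w ->
  u (q * (l ^ size w)%N + word_value l w)%R
    = word_map theta w (u q).
Proof.
move=> u_fixed wl; rewrite -iter_subst_biseq //.
suff -> : iter (size w) (subst_biseq theta) u = u by [].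
by elim: (size w) => //= n ->.
Qed.

(** * Primitivity *)

(** The letters of theta^n(b) are indexed by the n-digit words, so primitivity
    becomes a statement about compositions of column maps. *)
Lemma mem_iter_subst_word (A : finType) l (theta : A -> l.-tuple A) n a b :
  a \in iter n (subst_word theta) [:: b] ->
  exists w, [/\ size w = n, all (gtn l) w
    & word_map theta w b = a].
Proof.
elim: n a => [|n IH] a /=.
  by rewrite inE => /eqP ->; exists [::]; split=> //; rewrite ffunE.
case/flattenP => _ /mapP[c /IH [w [sw wl wb]] ->] /tnthP[i ->].
exists (val i :: w); split; rewrite /= ?sw ?ltn_ord //.
by rewrite delta_word_cons wb ffunE (tnth_nth c).
Qed.

(** The multiples t * n of the exponent are needed to match the length of a word
    with the period of a theta-periodic point; they are reached by looping at b
    before going to a. *)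
Lemma primitive_words (A : finType) l (theta : A -> l.-tuple A) :
  primitive theta ->
  exists2 n, (0 < n)%N & forall t a b, (0 < t)%N ->
    exists w, [/\ size w = (t * n)%N, all (gtn l) w
      & word_map theta w b = a].
Proof.
case=> n n0 prim; exists n => // -[] // t a b _; elim: t a => [|t IH] a.
  by rewrite mul1n; exact: mem_iter_subst_word (prim a b).
have [w [sw wl wa]] := mem_iter_subst_word (prim a b).
have [w' [sw' wl' wb]] := IH b.
exists (w ++ w'); split; first by rewrite size_cat sw sw' mulSn.
  by rewrite all_cat wl.
by rewrite delta_word_cat wb.
Qed.

(** For l = 1 there is only one word of each length, so primitivity leaves a
    single letter and u is shift-periodic; for l = 0 there is no nonempty word
    at all. *)
Lemma primitive_base_gt1 (A : finType) l (theta : A -> l.-tuple A) u :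
  primitive theta -> aperiodic theta -> fixed_point theta u -> (1 < l)%N.
Proof.
move=> /primitive_words[n n0 prim] aper ufix.
rewrite ltnNge; apply/negP => l1.
apply: (aper u); first by exists 1%N.
exists 1%N => //; apply/funext => m; rewrite /shift_by.
have trivial_word (w : seq nat) : all (gtn l) w -> w = nseq (size w) 0%N.
  elim: w => //= d w IH /andP[dl /IH {1}->]; have -> : d = 0%N by lia.
  by [].
have [w [sw /trivial_word Ew wa]] := prim 1%N (u m) (u m) isT.
have [w' [sw' /trivial_word Ew' <-]] := prim 1%N (u (m + 1)%R) (u m) isT.
by rewrite -[RHS]wa Ew' Ew sw sw'.
Qed.

Lemma primitive_occurs (A : finType) l (theta : A -> l.-tuple A) u a :
  primitive theta -> fixed_point theta u -> exists m : int, u m = a.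
Proof.
move=> /primitive_words[n n0 prim] ufix.
have [w [_ wl wa]] := prim 1%N a (u 0%R) isT.
by exists (0 * (l ^ size w)%N + word_value l w)%R;
  rewrite (fixed_point_delta_word 0%R ufix).
Qed.

(** * Pointwise topology on sequences and the l-adic integers *)

(** The sets containing a cylinder around f form a filter that converges to f in
    each coordinate, hence in the product topology, so this filter is finer
    than the neighbourhoods of f. *)
Lemma nbhs_ptws_cylinder (I : eqType) (V : discreteTopologicalType)
    (f : {ptws I -> V}) (U : set {ptws I -> V}) :
  nbhs f U ->
  exists s : seq I, forall g : I -> V,
    (forall i, i \in s -> g i = f i) -> U g.
Proof.
pose F : set_system {ptws I -> V} :=
  [set U | exists s : seq I, forall g : I -> V,
     (forall i, i \in s -> g i = f i) -> U g].
have FF : Filter F.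
  split.
  - by exists [::].
  - move=> P Q [s sP] [t tQ]; exists (s ++ t) => g gE; split.
    + by apply: sP => i si; apply: gE; rewrite mem_cat si.
    + by apply: tQ => i ti; apply: gE; rewrite mem_cat ti orbT.
  - by move=> P Q PQ [s sP]; exists s => g /sP /PQ.
have Ff : F --> f.
  apply/(cvg_sup _ f) => i P [_ [[W _ <-] /= Wfi OP]].
  exists [:: i] => g gE; apply: OP => /=.
  by rewrite gE ?inE.
exact: Ff.
Qed.

Lemma nbhs_ptws_coord (I : eqType) (V : discreteTopologicalType)
    (f : {ptws I -> V}) i :
  nbhs f [set g : {ptws I -> V} | g i = f i].
Proof.
have := @proj_continuous I (fun=> V) i f [set f i].
by apply; rewrite nbhs_principalE; apply/principal_filterP.
Qed.

Lemma biseq_compact (A : finType) : compact [set: biseq A].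
Proof.
have fin (_ : int) : compact [set: discrete_topology A].
  by apply: finite_compact; exact: (@finite_finset A).
have -> : [set: biseq A] = [set x | forall i, [set: discrete_topology A] (x i)].
  by apply/seteqP; split.
exact: (tychonoff fin).
Qed.

Lemma ptws_discrete_hausdorff (I : eqType) (V : discreteTopologicalType) :
  hausdorff_space {ptws I -> V}.
Proof.
by apply: (@hausdorff_product I (fun=> V)) => _; exact: discrete_hausdorff.
Qed.

Lemma orbit_closure_window (A : finType) (v x : biseq A) (s : seq int) :
  orbit_closure v x -> exists p : int, forall i, i \in s -> x i = v (i + p)%R.
Proof.
move=> /(_ [set y | forall i, i \in s -> y i = x i]) [].
  elim: s => [|i s IH]; first by apply: filterS filterT.
  apply: filterS (filterI (nbhs_ptws_coord (x : biseq A) i) IH) => y [yi ys] k.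
  by rewrite inE => /predU1P[->|/ys].
by move=> _ [[p _ <-] xE]; exists p => i /xE.
Qed.

Lemma orbit_closure_shift (A : finType) (v x : biseq A) (p : int) :
  orbit_closure v x -> orbit_closure v (shift_by p x).
Proof.
move=> vx U /nbhs_ptws_cylinder[s sU].
have [q xE] := orbit_closure_window [seq (i + p)%R | i <- s] vx.
exists (shift_by (p + q)%R v); split; first by exists (p + q)%R.
apply: sU => i si; rewrite /shift_by addrA xE //.
exact: (map_f (fun i : int => i + p)%R).
Qed.

Lemma odometer_modulus_ladic l n : odometer_modulus (ladic_seq l) n = (l ^ n)%N.
Proof. by rewrite /odometer_modulus prod_nat_const card_ord. Qed.

Lemma ladic_integers_modn l z i j : ladic_integers l z -> (i <= j)%N ->
  (z j %% l ^ i)%N = z i.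
Proof.
move=> zl; elim: j => [|j IH].
  rewrite leqn0 => /eqP ->; rewrite modn_small //.
  by case: (zl 0%N); rewrite odometer_modulus_ladic.
rewrite leq_eqVlt => /predU1P[->|ij].
  by rewrite modn_small //; case: (zl j.+1); rewrite odometer_modulus_ladic.
rewrite -(IH ij); case: (zl j); rewrite odometer_modulus_ladic => _ <-.
by rewrite modn_dvdm // dvdn_exp2l.
Qed.

(** A residue modulo l^j determines those modulo all smaller powers, so finitely
    many coordinates of an l-adic integer can be replaced by the last one. *)
Lemma nbhs_ladic l z U : ladic_integers l z -> nbhs z U ->
  exists j, forall z', ladic_integers l z' -> z' j = z j -> U z'.
Proof.
move=> zl /nbhs_ptws_cylinder[s sU]; exists (\max_(i <- s) i) => z' zl' Ez.
apply: sU => i si; have ij : (i <= \max_(i <- s) i)%N by exact: leq_bigmax_seq.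
by rewrite -(ladic_integers_modn zl ij) -(ladic_integers_modn zl' ij) Ez.
Qed.

(** * A Toeplitz substitution shift has a coincidence *)

Definition coincidence (A : finType) l (theta : A -> l.-tuple A) : Prop :=
  exists w c, all (gtn l) w /\ forall a, word_map theta w a = c.

(** Compactness turns the singleton fibre of x into a modulus of continuity: the
    points of the orbit closure that differ from x at 0 have a compact image
    that avoids the image of x, hence for some N it avoids the whole residue
    class of that image modulo l^N.  Shifting x by a multiple of l^N does not
    change this class. *)
Lemma toeplitz_essential_period (A : finType) l (v : biseq A) :
  toeplitz_shift_over (ladic_seq l) (orbit_closure v) ->
  exists2 x : int -> A, orbit_closure v x &
    exists N, forall m : nat, x (m * l ^ N)%N = x 0%R.
Proof.
case=> pi [pi_cont pi_onto pi_succ [x vx fibre]]; exists x => //.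
have pi_l y : orbit_closure v y -> ladic_integers l (pi y).
  by move=> vy; rewrite /ladic_integers -pi_onto; exists y.
have pi_shift (t N : nat) : pi (shift_by t x) N = ((pi x N + t) %% l ^ N)%N.
  elim: t => [|t IH].
    rewrite addn0 (_ : shift_by 0%N x = x); last first.
      by apply/funext => i; rewrite /shift_by addr0.
    by rewrite (ladic_integers_modn (pi_l _ vx)).
  have -> : shift_by t.+1 x = shift_by 1 (shift_by t x).
    by apply/funext => i; rewrite /shift_by; congr x; lia.
  rewrite pi_succ ?/odometer_succ; last exact: orbit_closure_shift.
  by rewrite odometer_modulus_ladic IH -addn1 modnDml addn1 addnS.
pose K : set (biseq A) := orbit_closure v `&` ~` [set y | y 0%R = x 0%R].
have openx : open [set y : biseq A | y 0%R = x 0%R].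
  rewrite openE => y yx; apply: filterS (nbhs_ptws_coord (y : biseq A) 0%R).
  by move=> z /= ->.
have Kcompact : compact K.
  apply: compact_closedI; last exact: open_closedC.
  apply: subclosed_compact (@biseq_compact A) _ => //; exact: closed_closure.
have piK_closed : closed (pi @` K).
  apply: compact_closed; first exact: ptws_discrete_hausdorff.
  apply: continuous_compact Kcompact; apply: continuous_subspaceW pi_cont.
  by move=> y [].
have xK : (~` (pi @` K)) (pi x).
  by move=> [y [vy yx] Epi]; apply: yx; rewrite (fibre y).
have [N KN] := nbhs_ladic (pi_l _ vx)
  (open_nbhs_nbhs (conj (closed_openC piK_closed) xK)).
exists N => m; apply: contrapT => xm.
pose y := shift_by (m * l ^ N)%N x.
have vy : orbit_closure v y by exact: orbit_closure_shift.
apply: (KN (pi y)); first exact: pi_l.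
  by rewrite pi_shift addnC modnMDl (ladic_integers_modn (pi_l _ vx)).
by exists y => //; split=> //; rewrite /= /y /shift_by add0r.
Qed.

(** A power of theta fixes v, so v is a concatenation of images of letters under
    a higher power, each of which contains every letter.  A window that is
    twice as long as these images contains a whole one. *)
Lemma periodic_window (A : finType) l (theta : A -> l.-tuple A) v :
  (0 < l)%N -> primitive theta -> theta_periodic theta v ->
  exists L : nat, forall (p : int) (a : A),
    exists2 m : nat, (m < L)%N & v (p + m)%R = a.
Proof.
move=> l0 /primitive_words[n n0 prim] [k k0 vk].
pose M := (l ^ (k * n))%N.
have M0 : (0 < M)%N by rewrite expn_gt0 l0.
have vM : iter (k * n) (subst_biseq theta) v = v.
  rewrite mulnC; elim: (n) => // t IH.
  by rewrite mulSn iterD IH.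
exists (2 * M)%N => p a.
(* The first multiple of M after p is Q * M. *)
pose Q : int := ((p %/ M)%Z + 1)%R.
have [w [sw wl wa]] := prim k a (v Q) k0.
have wM : (word_value l w < M)%N by rewrite /M -sw word_value_lt.
have := iter_subst_biseq theta v Q wl; rewrite wa sw vM => vQ.
have pE := divz_eq p M; have := modz_ge0 p (_ : M%:Z != 0)%R.
have := ltz_pmod p (_ : 0 < M%:Z)%R.
move=> /(_ ltac:(lia)) H1 /(_ ltac:(lia)) H2.
exists `|(Q * M + word_value l w - p)%R|%N; first by rewrite /Q; lia.
rewrite -vQ; congr v; rewrite /Q /M; lia.
Qed.

(** On a window that starts at position p of v, the composition of column maps
    read off the residue of p modulo l^N sends consecutive letters of v to the
    letters of x along its essential period, which are all equal to x 0. *)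
Lemma toeplitz_coincidence (A : finType) l (theta : A -> l.-tuple A) X :
  (0 < l)%N -> primitive theta -> is_substitution_shift theta X ->
  toeplitz_shift_over (ladic_seq l) X ->
  coincidence theta.
Proof.
move=> l0 prim [v vper ->] /toeplitz_essential_period[x vx [N0 xN0]].
have [L vL] := periodic_window l0 prim vper.
have [k k0 vk] := vper.
(* The exponent N serves twice: l^N0 divides l^N, and theta^N fixes v. *)
pose N := (N0 * k)%N; pose M := (l ^ N)%N.
have M0 : (0 < M)%N by rewrite expn_gt0 l0.
have vN : iter N (subst_biseq theta) v = v.
  by rewrite /N; elim: (N0) => // t IH; rewrite mulSn iterD IH.
have [p xv] := orbit_closure_window [seq Posz (m * M) | m <- iota 0 L] vx.
pose w := digits l N `|(p %% M)%Z|%N.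
have wl : all (gtn l) w.
  by apply/allP => d /mapP[i _ ->] /=; rewrite ltn_mod.
have sw : size w = N by rewrite size_mkseq.
have modp := modz_ge0 p (_ : M%:Z != 0)%R.
have wv : word_value l w = `|(p %% M)%Z|%N.
  rewrite word_value_digits // modn_small //.
  have := ltz_pmod p (_ : 0 < M%:Z)%R; rewrite -/M.
  move: modp => /(_ ltac:(lia)); move=> ? /(_ ltac:(lia)); lia.
exists w, (x 0%R); split=> // a.
have [m mL va] := vL (p %/ M)%Z a.
rewrite -va -iter_subst_biseq // sw vN wv.
have -> : x 0%R = x (m * M)%N.
  by rewrite /M /N -(prednK k0) mulnS addnC expnD mulnA xN0.
rewrite xv; last by apply/mapP; exists m; rewrite ?mem_iota.
congr v; have := divz_eq p M; move: modp => /(_ ltac:(lia)); rewrite -/M; lia.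
Qed.

(** * The periodic part *)

(** If the constancy on the class of n modulo k does not already count for k, it
    is because n has been taken into account for a proper divisor of k. *)
Lemma PerP (A : finType) (x : int -> A) (n : int) :
  Per x n <-> exists2 k : nat, (0 < k)%N &
    forall n' : int, (n' = n %[mod k])%Z -> x n' = x n.
Proof.
split=> [[k k0 [a _ /(Per_letterE x a n k0)[xa _]]]|[k]].
  by exists k => // n' /xa ->; rewrite xa.
elim/ltn_ind: k => k IH k0 xk.
have [[j [b [jk jltk jb]]]|noj] :=
    pselect (exists j b, [/\ (j %| k)%N, (j < k)%N & Per_letter x j b n]).
  by exists j; [exact: dvdn_gt0 jk | exists b].
exists k => //; exists (x n) => //; apply/(Per_letterE _ _ _ k0).
by split=> // j jk jltk b jb; apply: noj; exists j, b.
Qed.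

(** Peeling off gcd(k, l) repeatedly leaves the part of k that is coprime
    to l. *)
Lemma dvdn_coprime_mul_exp l k : (0 < k)%N ->
  exists q j, [/\ (0 < q)%N, coprime q l & (k %| q * l ^ j)%N].
Proof.
elim/ltn_ind: k => k IH k0.
have [kl|kl] := boolP (coprime k l).
  by exists k, 0%N; split=> //; rewrite muln1.
pose g := gcdn k l.
have g1 : (1 < g)%N.
  have : (0 < g)%N by rewrite gcdn_gt0 k0.
  by move: kl; rewrite /coprime -/g; lia.
have gk : (g %| k)%N by exact: dvdn_gcdl.
have kg0 : (0 < k %/ g)%N by rewrite divn_gt0 ?(ltnW g1) // dvdn_leq.
have [|q [j [q0 ql kq]]] := IH (k %/ g)%N _ kg0; first exact: ltn_Pdiv.
exists q, j.+1; split=> //.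
rewrite expnSr mulnA -(divnK gk); apply: dvdn_mul => //.
exact: dvdn_gcdr.
Qed.

(** A coincidence followed by a word leading from its value to a makes u equal
    to a on a whole progression whose difference is a power of l.  Since q is
    coprime to that difference, the progression meets every class modulo q.
    Without a coincidence this can fail, namely when theta has nontrivial
    height. *)
Lemma occurs_in_residue_class (A : finType) l (theta : A -> l.-tuple A) u
    (a : A) (e : int) (q : nat) :
  primitive theta -> fixed_point theta u ->
  coincidence theta ->
  (0 < q)%N -> coprime q l ->
  exists m : int, u (e + m * q)%R = a.
Proof.
move=> /primitive_words[n n0 prim] ufix [w [c [wl wc]]] q0 ql.
have [w1 [_ w1l w1a]] := prim 1%N a c isT.
pose W := w1 ++ w.
have Wl : all (gtn l) W by rewrite all_cat w1l.
have uW (t : int) : u (t * (l ^ size W)%N + word_value l W)%R = a.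
  by rewrite (fixed_point_delta_word t ufix Wl) delta_word_cat wc.
have /(coprimeXr (size W)) : coprime q l by [].
move: uW; set M := (l ^ size W)%N; set V := word_value l W => uW qM.
have [[r s] /= rs] : exists rs : int * int, (rs.1 * q + rs.2 * M = 1)%R.
  have := Bezoutz q M; case=> r [s E]; exists (r, s) => /=.
  rewrite E; move: qM; rewrite /coprime /gcdz /= => /eqP ->. by [].
exists ((V%:Z - e) * r)%R; rewrite -(uW ((e - V%:Z) * s)%R); congr u.
by have /= := congr1 (fun t => (V%:Z - e) * t)%R rs; rewrite mulr1; lia.
Qed.

(** The canonical word determines n up to its tail of digits, which stands for
    e = 0 or e = -1 according to the sign of n. *)
Lemma canonical_word_expansion l (n : int) : (1 < l)%N ->
  let w := canonical_word l n in
  let e : int := if (0 <= n)%R then 0%R else (-1)%R in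
  all (gtn l) w /\ n = (e * (l ^ size w)%N + word_value l w)%R.
Proof.
move=> l1 w e; have l0 : (0 < l)%N by exact: ltnW.
have digl j m : all (gtn l) (digits l j m).
  by apply/allP => d /mapP[i _ ->] /=; rewrite ltn_mod.
rewrite {}/w {}/e; case: n => m; rewrite /canonical_word.
  have -> : (0 <= Posz m)%R by [].
  split=> //.
  rewrite word_value_digits // modn_small ?mul0r ?add0r //.
  exact: trunc_log_ltn.
have -> : (0 <= Negz m)%R = false by [].
rewrite all_rcons size_rcons -cats1 word_value_cat word_value_digits //.
rewrite size_mkseq [word_value l [:: _]]/=.
have mlt : (m.+1 < l ^ expansion_length l m.+1)%N by exact: trunc_log_ltn.
split; first by rewrite digl andbT /=; lia.
rewrite modn_small; last by lia.
rewrite expnS; move: mlt; set M := (l ^ _)%N => mlt.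
rewrite muln0 addn0 NegzE; nia.
Qed.

(** The equation e * l + c = e says that the tail of digits c = 0 or c = l - 1
    is the expansion of e, which makes it possible to lengthen the word. *)
Lemma tail_word_expansion l (n : int) : (1 < l)%N ->
  exists w c (e : int), [/\ tail_word l n = rcons w c,
    c = 0%N \/ c = l.-1, all (gtn l) (rcons w c), (e * l + c = e)%R
    & n = (e * (l ^ size (rcons w c))%N + word_value l (rcons w c))%R].
Proof.
move=> l1; have := canonical_word_expansion n l1.
case: n => m; rewrite /tail_word [(0 <= _)%R]/= => -[wl wE]; last first.
  move: wl wE; rewrite /canonical_word; set w := digits _ _ _ => wl wE.
  by exists w, l.-1, (-1)%R; split=> //; [right|lia].
move: wl wE; set w := canonical_word _ _ => wl wE.
exists w, 0%N, 0%R; split=> //; first by left.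
  by rewrite all_rcons wl andbT; exact: ltnW.
rewrite -cats1 word_value_cat /= !muln0 addn0 mul0r add0r.
by rewrite wE mul0r add0r.
Qed.

Lemma Per_word (A : finType) l (theta : A -> l.-tuple A) u (n e : int) w a :
  (0 < l)%N -> fixed_point theta u -> all (gtn l) w ->
  n = (e * (l ^ size w)%N + word_value l w)%R ->
  word_map theta w = ffun_cst a -> Per u n.
Proof.
move=> l0 ufix wl nE wa; apply/PerP.
exists (l ^ size w)%N; first by rewrite expn_gt0 l0.
have ua (q : int) : u (q * (l ^ size w)%N + word_value l w)%R = a.
  by rewrite (fixed_point_delta_word q ufix wl) wa ffunE.
have nM : (n %% (l ^ size w)%N)%Z = word_value l w.
  by rewrite nE modzMDl modz_small // ltz_nat word_value_lt.
move=> n'; rewrite nM => n'M.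
by rewrite (divz_eq n' (l ^ size w)%N) n'M ua nE ua.
Qed.

(** Reducing modulo a power of l alone does not suffice, as the period of u at n
    could have a factor coprime to l: this factor is absorbed by the choice,
    inside a residue class, of the positions where the letters occur. *)
Lemma Per_tail_word (A : finType) l (theta : A -> l.-tuple A) u (n : int) :
  (1 < l)%N -> primitive theta -> simplified theta -> fixed_point theta u ->
  coincidence theta ->
  Per u n <-> word_map theta (tail_word l n) = ffun_cst (u n).
Proof.
move=> l1 prim [idem0 ideml] ufix coin; have l0 : (0 < l)%N by exact: ltnW.
have [w0 [c [e [-> cE wl ecE nE]]]] := tail_word_expansion n l1.
move: wl nE; set w := rcons w0 c => wl nE.
split; last exact: Per_word nE.
case/PerP=> k k0 uk.
have [q [j [q0 ql kq]]] := dvdn_coprime_mul_exp l k0.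
(* Appending j tail digits brings in the factor l^j of the period. *)
pose w' := w ++ nseq j c.
have w'l : all (gtn l) w'.
  rewrite all_cat wl all_nseq; apply/orP; right.
  by move: wl; rewrite all_rcons => /andP[].
have idemc a : column theta c (column theta c a) = column theta c a.
  by case: cE => ->; [exact: idem0|exact: ideml].
have w'E a : word_map theta w' a = word_map theta w a.
  rewrite /w' /w -cats1 -catA !delta_word_cat; congr (word_map _ _ _).
  have c1 b : word_map theta [:: c] b = column theta c b.
    by rewrite delta_word_cons [X in column _ _ X]ffunE.
  rewrite !c1; elim: (j) => [|t IH].
    by congr (column _ _ _); rewrite ffunE.
  by rewrite delta_word_cons idemc.
have nE' : n = (e * (l ^ size w')%N + word_value l w')%R.
  rewrite nE /w' size_cat word_value_cat size_nseq expnD.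
  have {1}-> : e = (e * (l ^ j)%N + word_value l (nseq j c))%R.
    elim: (j) => [|t IH] /=; first by rewrite expn0; lia.
    by have /= := congr1 (fun i => i * l%:Z)%R IH; rewrite expnS; lia.
  by lia.
apply/ffunP => a; rewrite -w'E ffunE.
have [m <-] := occurs_in_residue_class a e prim ufix coin q0 ql.
rewrite -(fixed_point_delta_word _ ufix w'l); apply: uk.
apply/eqP; rewrite eqz_mod_dvd.
have -> : ((e + m * q) * (l ^ size w')%N + word_value l w' - n
   = (m * (l ^ size w)%N) * (q * l ^ j)%N :> int)%R.
  rewrite nE' /w' size_cat size_nseq expnD; lia.
by apply: dvdz_mull; rewrite dvdzE.
Qed.

(** * Discontinuities and the reduced graph *)

Lemma ladic_of_int_integer l (n : int) : (0 < l)%N ->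
  ladic_integers l (ladic_of_int l n).
Proof.
move=> l0 j; rewrite /ladic_of_int /odometer_of_int !odometer_modulus_ladic.
have M0 : (0 < l ^ j)%N by rewrite expn_gt0 l0.
move: M0; rewrite expnS; set M := (l ^ j)%N => M0.
have M1 : (0 < l * M)%N by rewrite muln_gt0 l0.
have := modz_ge0 n (_ : M%:Z != 0)%R; have := ltz_pmod n (_ : 0 < M%:Z)%R.
move=> /(_ ltac:(lia)) ? /(_ ltac:(lia)) ?; split; first by lia.
apply/eqP; rewrite -eqz_nat -modz_nat.
have -> : Posz `|(n %% (l * M)%N)%Z| = (n %% (l * M)%N)%Z.
  by rewrite gez0_abs // modz_ge0 //; lia.
rewrite gez0_abs // eqz_mod_dvd {2}(divz_eq n (l * M)%N).
rewrite opprD addrCA subrr addr0.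
by rewrite dvdzE abszN abszM /= mulnA dvdn_mull.
Qed.

Lemma ladic_digit_lt l z k : (0 < l)%N -> ladic_integers l z ->
  (ladic_digit l z k < l)%N.
Proof.
move=> l0 zl; rewrite /ladic_digit ltn_divLR ?expn_gt0 ?l0 // -expnS.
by case: (zl k.+1); rewrite odometer_modulus_ladic.
Qed.

Lemma word_value_ladic l z j : ladic_integers l z ->
  word_value l (mkseq (ladic_digit l z) j) = z j.
Proof.
move=> zl; elim: j => [|j IH].
  by case: (zl 0%N); rewrite odometer_modulus_ladic /=; lia.
rewrite mkseqS -cats1 word_value_cat IH size_mkseq /= muln0 addn0 /ladic_digit.
by rewrite -(ladic_integers_modn zl (leqnSn j)) addnC mulnC -divn_eq.
Qed.

(** Near z the integers are those congruent to z_j modulo l^j, and there u runs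
    through the image of the map reached by the first j digits of z, as all
    letters occur in u. *)
Lemma ladic_limitP (A : finType) l (theta : A -> l.-tuple A) u z :
  (0 < l)%N -> primitive theta -> fixed_point theta u -> ladic_integers l z ->
  (exists a : A, exists2 U, nbhs (z : {ptws nat -> nat}) U &
     forall n : int, U (ladic_of_int l n) -> u n = a)
  <-> exists j a, word_map theta (mkseq (ladic_digit l z) j)
                  = ffun_cst a.
Proof.
move=> l0 prim ufix zl.
have wl j : all (gtn l) (mkseq (ladic_digit l z) j).
  by apply/allP => d /mapP[k _ ->] /=; exact: ladic_digit_lt.
have uE j (q : int) : u (q * (l ^ j)%N + z j)%R
    = word_map theta (mkseq (ladic_digit l z) j) (u q).
  have := fixed_point_delta_word q ufix (wl j).
  by rewrite size_mkseq word_value_ladic.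
have zj j : (z j < l ^ j)%N by case: (zl j); rewrite odometer_modulus_ladic.
split=> [[a [U /(nbhs_ladic zl)[j jU] Ua]]|[j [a ja]]].
  exists j, a; apply/ffunP => b; rewrite ffunE.
  have [q <-] := primitive_occurs b prim ufix; rewrite -uE; apply/Ua/jU.
    exact: ladic_of_int_integer.
  rewrite /ladic_of_int /odometer_of_int odometer_modulus_ladic modzMDl.
  by rewrite modz_small // ltz_nat zj.
exists a; exists [set z' : {ptws nat -> nat} | z' j = z j].
  exact: nbhs_ptws_coord.
move=> n /=; rewrite /ladic_of_int /odometer_of_int odometer_modulus_ladic.
move=> nj.
have -> : n = ((n %/ (l ^ j)%N)%Z * (l ^ j)%N + z j)%R.
  rewrite {1}(divz_eq n (l ^ j)%N) -nj gez0_abs // modz_ge0 //.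
  by have := zj j; lia.
by rewrite uE ja ffunE.
Qed.

(** The letter a0 makes the alphabet nonempty, without which constant maps have
    an empty image. *)
Lemma one_vertexP (A : finType) (s : {ffun A -> A}) (a0 : A) :
  one_vertex s <-> exists a, s = ffun_cst a.
Proof.
split=> [/eqP/cards1P[a sE]|[a ->]].
  exists a; apply/ffunP => b; rewrite ffunE; apply/set1P; rewrite -sE.
  exact: imset_f.
apply/eqP/cards1P; exists a; apply/setP => b; rewrite inE.
apply/imsetP/eqP => [[c _ ->]|->]; first by rewrite ffunE.
by exists a0; rewrite ?ffunE.
Qed.

Lemma reduced_infinite_pathP (A : finType) l (theta : A -> l.-tuple A) d :
  (forall k, d k < l)%N ->
  reduced_infinite_path theta d <->
  forall j, ~ one_vertex (word_map theta (mkseq d j)).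
Proof.
move=> dl; have deltaS j : word_map theta (mkseq d j.+1)
    = delta theta (word_map theta (mkseq d j)) (d j).
  by rewrite mkseqS /delta_word foldl_rcons.
have semi j : column_semigroup theta (word_map theta (mkseq d j)).
  elim: j => [|j IH]; first exact: semigroup_id.
  by rewrite deltaS; exact: delta_semigroup.
split=> [[v [v0 vS]] j|path].
  suff <- : v j = word_map theta (mkseq d j).
    by case: (vS j) => -[].
  by elim: j => // j IH; rewrite deltaS -IH; case: (vS j).
by exists (fun j => word_map theta (mkseq d j)); split=> //.
Qed.

(** The integer n belongs to each of its own neighbourhoods, so the limit of u
    at n can only be u n: continuity at n is the existence of a limit. *)
Lemma discontinuityP (A : finType) l (u : int -> A) (n : int) :
  {for (n : initial_topology (ladic_of_int l)), continuous (@semicocycle _ l u)}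
  <-> exists a : A, exists2 U, nbhs (ladic_of_int l n) U &
        forall m : int, U (ladic_of_int l m) -> u m = a.
Proof.
split=> [un|[a [U nU Ua]]].
  have : nbhs (@semicocycle _ l u n) [set u n].
    by rewrite nbhs_principalE; apply/principal_filterP.
  move=> /un [_ [[U oU <-] /= Un sU]]; exists (u n), U => //.
    exact: open_nbhs_nbhs.
  move=> P; rewrite nbhs_principalE => /principal_filterP Pun.
have una : u n = a by apply: Ua; exact: nbhs_singleton.
have := @initial_continuous int _ (ladic_of_int l) n U nU.
rewrite !nbhs_filterE.
apply: (@filterS _ (nbhs (n : initial_topology (ladic_of_int l)))) => m /Ua uma.
by rewrite /= /semicocycle uma -una.
Qed.

Theorem theorem22 (A : finType) (l : nat) (theta : A -> l.-tuple A)
    (X : set (biseq A)) (u : int -> A)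
    (theta_primitive : primitive theta)
    (theta_aperiodic : aperiodic theta)
    (theta_simplified : simplified theta)
    (X_theta : is_substitution_shift theta X)
    (u_fixed : fixed_point theta u)
    (u_generated : generated_by_automaton theta u)
    (X_toeplitz : toeplitz_shift_over (ladic_seq l) X) :
  [/\ [set n : int | delta_word theta (ffun_id A) (canonical_word l n)
                       = ffun_cst (u n)] `<=` Per u,
      Per u = [set n : int | delta_word theta (ffun_id A) (tail_word l n)
                               = ffun_cst (u n)],
      integer_discontinuities l u =
        [set n : int | reduced_infinite_path theta
                         (ladic_digit l (ladic_of_int l n))] &
      ladic_discontinuities l u =
        [set z | ladic_integers l z /\
                 reduced_infinite_path theta (ladic_digit l z)]].
Proof.
have l1 := primitive_base_gt1 theta_primitive theta_aperiodic u_fixed.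
have l0 : (0 < l)%N by exact: ltnW.
have coin := toeplitz_coincidence l0 theta_primitive X_theta X_toeplitz.
have path_limit z : ladic_integers l z ->
    reduced_infinite_path theta (ladic_digit l z) <->
    ~ exists a : A, exists2 U, nbhs (z : {ptws nat -> nat}) U &
        forall n : int, U (ladic_of_int l n) -> u n = a.
  move=> zl; rewrite (ladic_limitP l0 theta_primitive u_fixed zl).
  rewrite reduced_infinite_pathP; last by move=> k; exact: ladic_digit_lt.
  split=> [path [j ja]|nocst j /(one_vertexP _ (u 0%R)) ja]; last first.
    by apply: nocst; exists j.
  by apply: (path j); apply/(one_vertexP _ (u 0%R)).
split.
- move=> n nw; have [wl nE] := canonical_word_expansion n l1.
  exact: Per_word l0 u_fixed wl nE nw.
- have PerE n :=
    Per_tail_word n l1 theta_primitive theta_simplified u_fixed coin.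
  by apply/seteqP; split=> n /PerE.
- apply/seteqP; split=> n.
    rewrite /integer_discontinuities /= discontinuityP.
    by move/path_limit; apply; exact: ladic_of_int_integer.
  rewrite /integer_discontinuities /= discontinuityP.
  by move/path_limit; apply; exact: ladic_of_int_integer.
- by apply/seteqP; split=> z [zl] /(path_limit z zl).
Qed.
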